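(* Let $\mathbb{F}$ be a field and let $n \geq 3$ be an integer. Then the orthogonality graph $O(T_n)$ of the ring $T_n$ of upper triangular $n\times n$ matrices over $\mathbb{F}$ is connected and $\operatorname{diam} O(T_n) = 4$.
   Context: $\mathbb{F}$ is an arbitrary field (finite or infinite). $T_n = T_n(\mathbb{F})$ denotes the ring of all upper triangular matrices in $M_n(\mathbb{F})$. Two elements $r_1, r_2$ of an associative ring $R$ with unity are orthogonal if $r_1 r_2 = r_2 r_1 = 0$. The orthogonality graph $O(R)$ is the graph whose vertex set consists of all non-zero two-sided zero divisors of $R$ (elements that are both left and right zero divisors), in which two vertices are connected by an edge if and only if they are orthogonal. The distance $d(u,v)$ between two vertices is the length (number of edges) of a shortest path between them, with $d(u,u)=0$ and $d(u,v)=\infty$ if there is no path from $u$ to $v$. The graph is connected if there is a path between any two vertices. The diameter $\operatorname{diam}$ of a graph is the maximum of the distances between its vertices over all pairs of vertices. *)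

(* Defs.v *)
From HB Require Import structures.
From mathcomp Require Import all_boot all_order all_algebra.
From mathcomp Require Import boolp constructive_ereal.

Set Implicit Arguments.
Unset Strict Implicit.
Unset Printing Implicit Defensive.

Import Order.TTheory GRing.Theory.
Local Open Scope ring_scope.

Section Graph.

(* A graph is a (possibly infinite) vertex type V with an adjacency relation.
   Loops, if any, play no role in connectedness and distances. *)
Variables (V : Type) (adj : rel V).

Definition walk (u v : V) (k : nat) : Prop :=
  exists p : seq V, [/\ path adj u p, last u p = v & size p = k].

Definition connected_graph : Prop := forall u v : V, exists k, walk u v k.

Let walkb (u v : V) : pred nat := fun k => `[< walk u v k >].

Definition dist (u v : V) : \bar int :=
  if pselect (exists k, walkb u v k) is left ex_walk
  then (ex_minn ex_walk)%:Z%:E else +oo%E.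

Definition is_diam (d : \bar int) : Prop :=
  (exists u v : V, dist u v = d) /\ (forall u v : V, (dist u v <= d)%E).

End Graph.

Section OrthogonalityGraph.

(* pzRingType: associative rings with unity, not necessarily commutative, the
   zero ring being allowed. *)
Variable R : pzRingType.

Definition left_zero_divisor (x : R) : Prop := exists2 y : R, y != 0 & x * y = 0.

Definition right_zero_divisor (x : R) : Prop := exists2 y : R, y != 0 & y * x = 0.

Definition orthogonal_elts (x y : R) : bool := (x * y == 0) && (y * x == 0).

Definition Overtex_pred : pred R := fun x =>
  `[< [/\ x != 0, left_zero_divisor x & right_zero_divisor x] >].

Definition Overtex : Type := {x : R | Overtex_pred x}.

Definition Oadj : rel Overtex := fun u v => orthogonal_elts (val u) (val v).

End OrthogonalityGraph.

Section UpperTriangularRing.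

Variables (F : fieldType) (n : nat).

(* is_trig_mx is the predicate of lower triangular matrices. *)
Definition upper_trig : {pred 'M[F]_n} := fun A => is_trig_mx A^T.

Lemma upper_trigP (A : 'M[F]_n) :
  reflect (forall i j : 'I_n, (j < i)%N -> A i j = 0) (A \in upper_trig).
Proof.
apply: (iffP is_trig_mxP) => A0 i j ij; last by rewrite mxE A0.
by have := A0 j i ij; rewrite mxE.
Qed.

Lemma upper_trig_subring : subring_closed upper_trig.
Proof.
split=> [|A B /upper_trigP A0 /upper_trigP B0|A B /upper_trigP A0 /upper_trigP B0];
  apply/upper_trigP => i j ij.
- by rewrite (_ : 1 = 1%:M) // mxE -val_eqE gtn_eqF.
- by rewrite !mxE A0 // B0 // subr0.
- rewrite (_ : A * B = A *m B) // mxE big1 // => k _; have [ki|ik] := ltnP k i; first by rewrite A0 // mul0r.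
  by rewrite B0 ?mulr0 // (leq_trans ij ik).
Qed.

Record upper_trig_mx := UpperTrigMx {
  upper_trig_val :> 'M[F]_n;
  _ : upper_trig_val \in upper_trig
}.

HB.instance Definition _ := [isSub for upper_trig_val].
HB.instance Definition _ := [Choice of upper_trig_mx by <:].
HB.instance Definition _ :=
  GRing.SubChoice_isSubPzRing.Build 'M[F]_n _ upper_trig_mx upper_trig_subring.

End UpperTriangularRing.

Notation "''T[' F ]_ n" := (upper_trig_mx F n)
  (at level 8, n at level 2, format "''T[' F ]_ n") : type_scope.

(* Main.v *)
Require Import Defs.
From mathcomp Require Import all_boot all_order all_algebra.
From mathcomp Require Import boolp.
From mathcomp Require Import constructive_ereal.

(** A singular upper triangular matrix [A] has a zero diagonal entry, say at
    position [i]. The leading block ending there and the trailing block starting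
    there are singular too, so there are a column [u] supported on indices [<= i]
    with [A u = 0] and a row [v] supported on indices [>= i] with [v A = 0].
    The supports make the rank one matrix [u v] upper triangular, hence a
    neighbour of [A] ([has_rank1_annihilator]).

    Upper bound. Let [u v] and [u' v'] be such neighbours of [A] and [B], pivoted
    at [i] and [i']. A common neighbour of rank one is a product [p q] with
    [v p = v' p = 0] and [q u = q u' = 0] ([common_annihilator]). If both pivots
    differ from the first index, take for [p] the first basis vector, which makes
    every [p q] upper triangular, and for [q] any solution of the two equations,
    which exists because [n >= 3]; dually if both pivots differ from the last
    index. Otherwise one pivot is the first index and the other one the last.
    One of the two equations on each side is then void for [p] supported on the
    first two indices and [q] supported on the last two, so such [p] and [q]
    exist, and [p q] is upper triangular because again [n >= 3]. This gives a walk
    [A - u v - p q - u' v' - B].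

    Lower bound. For a row [v] with first entry [1], let [P_v] be the idempotent
    with first row [v] and all other rows zero. An element annihilated on both
    sides by [1 - P_v] is a multiple of [P_v] ([two_sided_annihilator_rank1]), and
    [P_v P_w = P_w]. If [v <> w], the neighbours of [1 - P_v] are hence neither
    equal nor orthogonal to those of [1 - P_w], and these two vertices are
    themselves distinct and not adjacent: their distance exceeds [3]. *)

Set Implicit Arguments.
Unset Strict Implicit.
Unset Printing Implicit Defensive.

Import Order.TTheory GRing.Theory.
Local Open Scope ring_scope.

(** * Distances and walks *)

Section Distance.

Variables (V : Type) (adj : rel V).

Lemma dist_le (u v : V) (k : nat) : walk adj u v k -> (dist adj u v <= k%:Z%:E)%E.
Proof.
move=> uv; rewrite /dist; case: pselect => [ex|]; last first.
  by case; exists k; apply/asboolP.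
by rewrite lee_fin lez_nat; case: ex_minnP => m _; apply; apply/asboolP.
Qed.

Lemma dist_eq (u v : V) (k : nat) : walk adj u v k ->
  (forall l, walk adj u v l -> (k <= l)%N) -> dist adj u v = k%:Z%:E.
Proof.
move=> uv kmin; rewrite /dist; case: pselect => [ex|]; last first.
  by case; exists k; apply/asboolP.
case: ex_minnP => m /asboolP/kmin km mmin.
by congr (_%:Z%:E); apply/eqP; rewrite eqn_leq km andbT mmin //; apply/asboolP.
Qed.

End Distance.

(** * Rank one matrices *)

Section RankOne.

Variables (F : fieldType) (n : nat).
Implicit Types (p u : 'cV[F]_n) (q v : 'rV[F]_n).

Lemma outer_neq0 p q : p != 0 -> q != 0 -> p *m q != 0.
Proof.
move=> /cV0Pn[i pi0] /rV0Pn[j qj0]; apply/eqP => /matrixP/(_ i j).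
by rewrite !mxE big_ord1 => /eqP; rewrite mulf_eq0 (negPf pi0) (negPf qj0).
Qed.

Lemma outer_upper_trig p q (a b : nat) : (a <= b)%N ->
  (forall k : 'I_n, (a < k)%N -> p k 0 = 0) ->
  (forall k : 'I_n, (k < b)%N -> q 0 k = 0) ->
  p *m q \in @upper_trig F n.
Proof.
move=> ab pa qb; apply/upper_trigP => i j ji; rewrite mxE big_ord1.
have [ai|ia] := ltnP a i; first by rewrite pa ?mul0r.
by rewrite qb ?mulr0 // (leq_trans ji) // (leq_trans ia).
Qed.

Lemma mulmx_disjoint q p :
  (forall k, q 0 k = 0 \/ p k 0 = 0) -> q *m p = 0.
Proof.
move=> qp; apply/matrixP => i j; rewrite !ord1 !mxE big1 // => k _.
by case: (qp k) => ->; rewrite ?mul0r ?mulr0.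
Qed.

Lemma orthogonal_on_pair v (a b : 'I_n) : a != b ->
  exists p, [/\ p != 0, v *m p = 0 & forall k, k != a -> k != b -> p k 0 = 0].
Proof.
move=> ab; have mul_delta k : v *m delta_mx k 0 = (v 0 k)%:M.
  by rewrite -colE; apply/matrixP => i j; rewrite !ord1 !mxE eqxx mulr1n.
have [va0|va0] := eqVneq (v 0 a) 0.
  exists (delta_mx a 0); split; first 1 last.
  - by rewrite mul_delta va0 raddf0.
  - by move=> k /negPf ka _; rewrite mxE ka.
  by apply/cV0Pn; exists a; rewrite mxE !eqxx oner_eq0.
exists (v 0 b *: delta_mx a 0 - v 0 a *: delta_mx b 0); split.
- apply/cV0Pn; exists b; rewrite !mxE !eqxx [b == a]eq_sym (negPf ab) /=.
  by rewrite mulr0 mulr1 sub0r oppr_eq0.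
- by rewrite mulmxBr -!scalemxAr !mul_delta !scale_scalar_mx mulrC subrr.
- by move=> k /negPf ka /negPf kb; rewrite !mxE ka kb /= !mulr0 subr0.
Qed.

Lemma orthogonal_to_two u u' : (2 < n)%N ->
  exists q, [/\ q != 0, q *m u = 0 & q *m u' = 0].
Proof.
move=> n2; have : kermx (row_mx u u') != 0.
  rewrite -mxrank_eq0 mxrank_ker subn_eq0 -ltnNge.
  exact: leq_ltn_trans (rank_leq_col _) n2.
move=> /rowV0Pn[q /sub_kermxP + q0].
by rewrite mul_mx_row -[RHS]row_mx0 => /eq_row_mx[qu qu']; exists q.
Qed.

End RankOne.

(** * Rank one neighbours of singular triangular matrices *)

Section Annihilators.

Variables (F : fieldType) (n : nat).
Implicit Types (A : 'M[F]_n) (S : pred 'I_n).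

Lemma det_upper_trig A : A \in @upper_trig F n -> \det A = \prod_i A i i.
Proof.
by rewrite -det_tr => /det_trig ->; apply: eq_bigr => i _; rewrite mxE.
Qed.

(** The determinant is that of the restriction of [A] to the coordinate subspace
    of [S], which [A] stabilises: completing by the identity outside [S] avoids
    changing the size of the matrix. *)
Lemma supported_kernel A S :
  (forall k l, S l -> ~~ S k -> A k l = 0) ->
  \det (\matrix_(k, l) if S l then A k l else (k == l)%:R) = 0 ->
  exists u : 'cV[F]_n, [/\ u != 0, A *m u = 0 & forall k, ~~ S k -> u k 0 = 0].
Proof.
move=> AS; set B := \matrix_(k, l) _; rewrite -det_tr => /eqP/det0P[w w0 wB].
have Bu : B *m w^T = 0 by rewrite -[B]trmxK -trmx_mul wB trmx0.
have uS k : ~~ S k -> w^T k 0 = 0.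
  move=> Sk; have := congr1 (fun M : 'cV_n => M k 0) Bu.
  rewrite !mxE (bigD1 k) //= big1 ?addr0 => [|l lk].
    by rewrite !mxE (negPf Sk) eqxx mul1r.
  rewrite !mxE; case: ifPn => Sl; first by rewrite AS ?mul0r.
  by rewrite eq_sym (negPf lk) mul0r.
exists w^T; split=> //.
  by apply: contra_neq w0 => /(congr1 trmx); rewrite trmxK trmx0.
rewrite -Bu; apply/matrixP => k j; rewrite !ord1 !mxE; apply: eq_bigr => l _.
rewrite [B k l]mxE; case: ifPn => // /uS ->.
by rewrite !mulr0.
Qed.

Definition pivoted_at (i : 'I_n) (u : 'cV[F]_n) (v : 'rV[F]_n) : Prop :=
  (forall k : 'I_n, (i < k)%N -> u k 0 = 0) /\
  (forall k : 'I_n, (k < i)%N -> v 0 k = 0).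

(** Both vectors come from the same zero on the diagonal, so that the supports
    meet in at most one index. *)
Lemma has_rank1_annihilator A : A \in @upper_trig F n -> \det A = 0 ->
  exists i u v, [/\ u != 0, v != 0, A *m u = 0, v *m A = 0 & pivoted_at i u v].
Proof.
move=> At detA; move/upper_trigP: (At) => A0.
have [i Aii] : exists i, A i i = 0.
  move/eqP: detA; rewrite det_upper_trig // => /prodf_eq0[i _ /eqP].
  by exists i.
have [||u [u0 Au ui]] := @supported_kernel A (fun k => k <= i)%N.
- by move=> k l li; rewrite -ltnNge => ik; rewrite A0 // (leq_ltn_trans li).
- rewrite det_upper_trig; last first.
    apply/upper_trigP => k l lk; rewrite mxE; case: ifP => _; first exact: A0.
    by rewrite -val_eqE gtn_eqF.
  by apply/eqP/prodf_eq0; exists i; rewrite // mxE leqnn Aii.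
have [||v [v0 Av vi]] := @supported_kernel A^T (fun k => i <= k)%N.
- by move=> k l il; rewrite -ltnNge => ki; rewrite mxE A0 // (leq_trans ki).
- rewrite det_trig; last first.
    apply/is_trig_mxP => k l kl; rewrite !mxE; case: ifP => _; first exact: A0.
    by rewrite -val_eqE ltn_eqF.
  by apply/eqP/prodf_eq0; exists i; rewrite // !mxE leqnn Aii.
exists i, u, v^T; split=> //.
- by apply: contra_neq v0 => /(congr1 trmx); rewrite trmxK trmx0.
- by rewrite -[A]trmxK -trmx_mul Av trmx0.
- by split=> k ik; [apply: ui | rewrite mxE; apply: vi]; rewrite -ltnNge.
Qed.

End Annihilators.

(** * Common neighbours of rank one matrices *)

Section CommonAnnihilator.

Variables (F : fieldType) (m : nat).
Local Notation n := m.+3.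
Implicit Types (u : 'cV[F]_n) (v : 'rV[F]_n).

(** Here [u] lives on the first index and [v'] on the last one, so a [p] supported
    on the first two indices only has to be orthogonal to [v], and a [q] supported
    on the last two only to [u']: one equation in two unknowns each. *)
Lemma common_annihilator_extreme u v u' v' :
  pivoted_at ord0 u v -> pivoted_at ord_max u' v' ->
  exists (p : 'cV[F]_n) (q : 'rV[F]_n), [/\ p != 0, q != 0, p *m q \in @upper_trig F n,
    v *m p = 0 /\ v' *m p = 0 & q *m u = 0 /\ q *m u' = 0].
Proof.
move=> [u0 _] [_ vmax].
have [p [p0 vp psupp]] := @orthogonal_on_pair F n v (inord 0) (inord 1)
  ltac:(by rewrite -val_eqE /= !inordK).
have [q [q0 uq qsupp]] :=
  @orthogonal_on_pair F n u'^T (inord m.+1) (inord m.+2)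
  ltac:(by rewrite -val_eqE /= !inordK // neq_ltn ltnSn).
have p_le1 (k : 'I_n) : (1 < k)%N -> p k 0 = 0.
  by move=> k1; apply: psupp; rewrite -val_eqE /= inordK // gtn_eqF // ltnW.
have q_ge (k : 'I_n) : (k < m.+1)%N -> q^T 0 k = 0.
  by move=> km; rewrite mxE qsupp // -val_eqE /= inordK // ltn_eqF // ltnW.
exists p, q^T; split=> //.
- by apply: contra_neq q0 => /(congr1 trmx); rewrite trmxK trmx0.
- exact: outer_upper_trig p_le1 q_ge.
- split=> //; apply: mulmx_disjoint => k.
  have [k1|k1] := ltnP 1 k; first by right; apply: p_le1.
  by left; apply: vmax; apply: leq_ltn_trans k1 _.
- split; last by rewrite -[u']trmxK -trmx_mul uq trmx0.
  apply: mulmx_disjoint => k; case: (posnP k) => k0; last by right; apply: u0.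
  by left; apply: q_ge; rewrite k0.
Qed.

(** When one end of the index range is not a pivot, its basis vector is orthogonal
    to both given vectors on its side and makes [p q] triangular whatever the other
    factor is. The equations in the four
    factors are what makes [p q] orthogonal to both [u v] and [u' v']. *)
Lemma common_annihilator i i' u v u' v' :
  pivoted_at i u v -> pivoted_at i' u' v' ->
  exists (p : 'cV[F]_n) (q : 'rV[F]_n), [/\ p != 0, q != 0, p *m q \in @upper_trig F n,
    v *m p = 0 /\ v' *m p = 0 & q *m u = 0 /\ q *m u' = 0].
Proof.
move=> piv piv'.
have [/andP[i0 i0']|not0] := boolP ((ord0 != i) && (ord0 != i')).
  have [q [q0 qu qu']] := orthogonal_to_two u u' (isT : 2 < n)%N.
  exists (delta_mx ord0 0), q; split=> //.
  - by apply/cV0Pn; exists ord0; rewrite mxE !eqxx oner_eq0.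
  - apply: (@outer_upper_trig _ _ _ _ 0 0) => // k k0.
    by rewrite mxE -val_eqE gtn_eqF.
  - rewrite -!colE; split; apply/matrixP => j l; rewrite !ord1 !mxE.
      by apply: piv.2; rewrite lt0n eq_sym.
    by apply: piv'.2; rewrite lt0n eq_sym.
have [/andP[im im']|notm] := boolP ((ord_max != i) && (ord_max != i')).
  have [p [p0 pv pv']] := orthogonal_to_two v^T v'^T (isT : 2 < n)%N.
  have ltm (j : 'I_n) : ord_max != j -> (j < @ord_max m.+2)%N.
    by move=> jm; rewrite ltn_neqAle eq_sym jm /= -ltnS.
  exists p^T, (delta_mx 0 ord_max); split=> //.
  - by apply: contra_neq p0 => /(congr1 trmx); rewrite trmxK trmx0.
  - by apply/rV0Pn; exists ord_max; rewrite mxE !eqxx oner_eq0.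
  - apply: (@outer_upper_trig _ _ _ _ m.+2 m.+2) => // k km.
      by have := ltn_ord k; rewrite ltnNge km.
    by rewrite mxE (_ : (k == ord_max) = false) ?andbF //; apply: ltn_eqF km.
  - by split; rewrite -[LHS]trmxK trmx_mul trmxK ?pv ?pv' trmx0.
  - rewrite -!rowE; split; apply/matrixP => j l; rewrite !ord1 !mxE.
      exact/piv.1/ltm.
    exact/piv'.1/ltm.
(* One pivot is the first index and one is the last; they cannot coincide. *)
move: not0 notm; rewrite !negb_and !negbK => /orP[]/eqP E; subst;
  move=> /orP[]/eqP // E; subst.
  exact: common_annihilator_extreme piv piv'.
have [p [q [p0 q0 pq [vp vp'] [qu qu']]]] := common_annihilator_extreme piv' piv.
by exists p, q.
Qed.

End CommonAnnihilator.

(** * Distances in the orthogonality graph *)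

Section Vertices.

Variables (F : fieldType) (n : nat).
Implicit Types (a b : Overtex 'T[F]_n).

Definition vmx a : 'M[F]_n := upper_trig_val (val a).

Lemma OadjE a b :
  Oadj a b = (vmx a *m vmx b == 0) && (vmx b *m vmx a == 0).
Proof. by []. Qed.

Lemma Oadj_sym a b : Oadj a b = Oadj b a.
Proof. by rewrite !OadjE andbC. Qed.

Lemma vmx_neq0 a : vmx a != 0.
Proof. by case: a => x vx; have /asboolP[x0 _ _] := vx. Qed.

Lemma vmx_upper_trig a : vmx a \in @upper_trig F n.
Proof. exact: valP (val a). Qed.

Lemma det_vmx a : \det (vmx a) = 0.
Proof.
case: a => x vx; have /asboolP[_ [y y0 /(congr1 val) xy] _] := vx.
apply/eqP/contraT => detx.
have /(congr1 (mulmx (invmx (val x)))) : val x *m val y = 0 by [].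
rewrite mulKmx ?unitmxE ?unitfE // mulmx0 => y_0.
by case/eqP: y0; apply: val_inj.
Qed.

Lemma vertex_of (X Y : 'M[F]_n) : X \in @upper_trig F n -> Y \in @upper_trig F n ->
  X != 0 -> Y != 0 -> X *m Y = 0 -> Y *m X = 0 -> exists a, vmx a = X.
Proof.
move=> tX tY X0 Y0 XY YX.
have vX : Overtex_pred (UpperTrigMx tX).
  by apply/asboolP; split=> //; exists (UpperTrigMx tY) => //; apply: val_inj.
by exists (exist (@Overtex_pred _) _ vX).
Qed.

Lemma neighbour_of a (X : 'M[F]_n) : X \in @upper_trig F n -> X != 0 ->
  vmx a *m X = 0 -> X *m vmx a = 0 -> exists2 b, vmx b = X & Oadj a b.
Proof.
move=> tX X0 aX Xa.
have [b bX] := vertex_of tX (vmx_upper_trig a) X0 (vmx_neq0 a) Xa aX.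
by exists b; rewrite // OadjE bX aX Xa eqxx.
Qed.

Lemma rank1_neighbour a : exists b i u v,
  [/\ Oadj a b, vmx b = u *m v & pivoted_at i u v].
Proof.
have [i [u [v [u0 v0 au va piv]]]] :=
  has_rank1_annihilator (vmx_upper_trig a) (det_vmx a).
have [|||| b bE ab] := @neighbour_of a (u *m v).
- exact: outer_upper_trig (leqnn i) piv.1 piv.2.
- exact: outer_neq0.
- by rewrite mulmxA au mul0mx.
- by rewrite -mulmxA va mulmx0.
by exists b, i, u, v.
Qed.

End Vertices.

Lemma walk4 (F : fieldType) (m : nat) (a b : Overtex 'T[F]_m.+3) :
  walk (@Oadj 'T[F]_m.+3) a b 4.
Proof.
have [x [i [u [v [ax xE piv]]]]] := rank1_neighbour a.
have [z [i' [u' [v' [bz zE piv']]]]] := rank1_neighbour b.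
have [p [q [p0 q0 pq [vp vp'] [qu qu']]]] := common_annihilator piv piv'.
have [||y yE xy] := neighbour_of (a := x) pq (outer_neq0 p0 q0).
- by rewrite xE mulmxA -(mulmxA u) vp mulmx0 mul0mx.
- by rewrite xE mulmxA -(mulmxA p) qu mulmx0 mul0mx.
exists [:: x; y; z; b]; split=> //=; rewrite ax xy (Oadj_sym z b) bz !andbT OadjE.
rewrite yE zE !mulmxA -(mulmxA p) qu' mulmx0 mul0mx eqxx /=.
by rewrite -(mulmxA u') vp' mulmx0 mul0mx.
Qed.

(** * Two vertices at distance at least four *)

Section FarVertices.

Variables (F : fieldType) (m : nat).
Local Notation n := m.+3.
Implicit Types (v w : 'rV[F]_n).

Definition first_row_mx v : 'M[F]_n := delta_mx ord0 0 *m v.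

Lemma first_row_mxE v i j : first_row_mx v i j = (i == ord0)%:R * v 0 j.
Proof. by rewrite mxE big_ord1 !mxE andbT. Qed.

Lemma first_row_mx_inj : injective first_row_mx.
Proof.
move=> v w /matrixP vw; apply/rowP => j.
by have := vw ord0 j; rewrite !first_row_mxE eqxx !mul1r.
Qed.

Lemma first_row_mx_trig v : first_row_mx v \in @upper_trig F n.
Proof.
apply/upper_trigP => i j ji; rewrite first_row_mxE -val_eqE gtn_eqF ?mul0r //.
exact: leq_ltn_trans ji.
Qed.

Lemma first_row_mxM v w : v 0 ord0 = 1 ->
  first_row_mx v *m first_row_mx w = first_row_mx w.
Proof.
move=> v1; rewrite /first_row_mx mulmxA -(mulmxA _ v) -colE.
suff -> : col ord0 v = 1%:M by rewrite mulmx1.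
by apply/matrixP => i j; rewrite !ord1 !mxE v1.
Qed.

Lemma first_row_mx_neq0 v : v 0 ord0 = 1 -> first_row_mx v != 0.
Proof.
move=> v1; apply/eqP => /matrixP/(_ ord0 ord0).
by rewrite first_row_mxE v1 !mxE mulr1 => /eqP; rewrite oner_eq0.
Qed.

Lemma sub1_first_row_mx_neq0 v : 1%:M - first_row_mx v != 0.
Proof.
apply/eqP => /matrixP/(_ ord_max ord_max).
rewrite mxE [X in _ + X]mxE first_row_mxE !mxE eqxx mul0r subr0 => /eqP.
by rewrite oner_eq0.
Qed.

Lemma far_vertex v : v 0 ord0 = 1 ->
  exists a : Overtex 'T[F]_n, vmx a = 1%:M - first_row_mx v.
Proof.
move=> v1; apply: (vertex_of _ (first_row_mx_trig v)).
- apply/upper_trigP => i j ji; have /upper_trigP tv := first_row_mx_trig v.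
  by rewrite mxE [X in _ + X]mxE tv // mxE -val_eqE gtn_eqF // subr0.
- exact: sub1_first_row_mx_neq0.
- exact: first_row_mx_neq0.
- by rewrite mulmxBl mul1mx first_row_mxM // subrr.
- by rewrite mulmxBr mulmx1 first_row_mxM // subrr.
Qed.

(** [X = P X P] for the rank one idempotent [P], and [P M P] is always a scalar
    multiple of [P]. *)
Lemma two_sided_annihilator_rank1 v (X : 'M[F]_n) :
  (1%:M - first_row_mx v) *m X = 0 -> X *m (1%:M - first_row_mx v) = 0 ->
  exists c, X = c *: first_row_mx v.
Proof.
rewrite mulmxBl mul1mx => /eqP; rewrite subr_eq0 => /eqP XP.
rewrite mulmxBr mulmx1 => /eqP; rewrite subr_eq0 => /eqP PX.
pose D : 'cV[F]_n := delta_mx ord0 0.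
have XE : X = D *m (v *m X *m D) *m v by rewrite {1}PX {1}XP /first_row_mx !mulmxA.
exists ((v *m X *m D) 0 0).
by rewrite {1}XE {1}[v *m X *m D]mx11_scalar mul_mx_scalar -scalemxAl.
Qed.

Lemma far_neighbour v a b : vmx a = 1%:M - first_row_mx v -> Oadj a b ->
  exists2 c, c != 0 & vmx b = c *: first_row_mx v.
Proof.
move=> aE; rewrite OadjE aE => /andP[/eqP ab /eqP ba].
have [c bE] := two_sided_annihilator_rank1 ab ba.
by exists c => //; apply: contra_neq (vmx_neq0 b) => c0; rewrite bE c0 scale0r.
Qed.

Lemma far_walk v w a b k : v 0 ord0 = 1 -> w 0 ord0 = 1 -> v != w ->
  vmx a = 1%:M - first_row_mx v -> vmx b = 1%:M - first_row_mx w ->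
  walk (@Oadj 'T[F]_n) a b k -> (4 <= k)%N.
Proof.
move=> v1 w1 vw aE bE [p [+ + <-]]; have w0 := first_row_mx_neq0 w1.
case: p => [|x [|y [|z [|t p]]]] //=.
- move=> _ ab; move: aE; rewrite ab bE => /addrI/oppr_inj/first_row_mx_inj wv.
  by rewrite wv eqxx in vw.
- move=> /andP[+ _] xb; rewrite xb => /(far_neighbour aE)[c c0].
  rewrite bE => /(congr1 (fun M => M *m first_row_mx w)).
  rewrite -scalemxAl mulmxBl mul1mx !first_row_mxM // subrr => /esym/eqP.
  by rewrite scaler_eq0 (negPf c0) (negPf w0).
- move=> /and3P[/(far_neighbour aE)[c c0 xE] + _] yb.
  rewrite yb Oadj_sym => /(far_neighbour bE)[d d0]; rewrite xE => cd.
  (* Multiplying on the right by [P_w] turns [P_v] into [P_w]. *)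
  have := congr1 (fun M => M *m first_row_mx w) cd.
  rewrite -!scalemxAl !first_row_mxM // -cd => /(scalerI c0)/first_row_mx_inj wv.
  by rewrite wv eqxx in vw.
- move=> /and4P[/(far_neighbour aE)[c c0 xE] + + _] zb.
  rewrite zb [Oadj y b]Oadj_sym => + /(far_neighbour bE)[d d0 yE].
  rewrite OadjE xE yE => /andP[+ _].
  rewrite -scalemxAl -scalemxAr first_row_mxM // !scaler_eq0.
  by rewrite (negPf c0) (negPf d0) (negPf w0).
Qed.

End FarVertices.

Theorem theorem2p8 (F : fieldType) (n : nat) (hn : (3 <= n)%N) :
  connected_graph (@Oadj 'T[F]_n) /\ is_diam (@Oadj 'T[F]_n) (Posz 4)%:E.
Proof.
case: n hn => [|[|[|m]]] // _.
split; first by move=> a b; exists 4%N; apply: walk4.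
split; last by move=> a b; apply: dist_le (walk4 a b).
pose v : 'rV[F]_m.+3 := delta_mx 0 ord0.
pose w : 'rV[F]_m.+3 := const_mx 1.
have v1 : v 0 ord0 = 1 by rewrite mxE !eqxx.
have w1 : w 0 ord0 = 1 by rewrite mxE.
have vw : v != w.
  apply/eqP => /rowP/(_ ord_max); rewrite !mxE andTb.
  by move/eqP; rewrite eq_sym oner_eq0.
have [a aE] := far_vertex v1; have [b bE] := far_vertex w1.
exists a, b; apply: dist_eq (walk4 a b) _ => l.
exact: far_walk v1 w1 vw aE bE.
Qed.
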